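(* With optimal play, for every $n\ge 1$, the mis\`ere SOO game on a $1\times n$ grid is a draw.
   Context: Mis\`ere SOO game: on a $1\times n$ grid, initially empty, two players alternately write either an S or an O in an empty cell. The first player whose move produces three consecutive cells which, read from left to right, spell SOO loses (no matter who wrote the individual letters). If all cells are filled without producing SOO, the play ends in a draw. ''With optimal play the game is a draw'' means that each player has a strategy guaranteeing that they do not lose. *)

(* Defs.v *)
From HB Require Import structures.
From mathcomp Require Import all_boot.

Set Implicit Arguments.
Unset Strict Implicit.
Unset Printing Implicit Defensive.

Inductive letter := LetterS | LetterO.

Definition bool_of_letter (l : letter) : bool :=
  if l is LetterS then true else false.
Definition letter_of_bool (b : bool) : letter :=
  if b then LetterS else LetterO.
Lemma bool_of_letterK : cancel bool_of_letter letter_of_bool.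
Proof. by case. Qed.

HB.instance Definition _ := Finite.copy letter (can_type bool_of_letterK).

Inductive player := First | Second.

(* Cells are numbered from left to right; None is an empty cell. *)
Definition board (n : nat) := {ffun 'I_n -> option letter}.

Definition move (n : nat) := ('I_n * letter)%type.

Definition empty_board (n : nat) : board n := [ffun=> None].

Definition write (n : nat) (b : board n) (m : move n) : board n :=
  [ffun i => if i == m.1 then Some m.2 else b i].

(* Histories list the moves in chronological order. *)
Definition board_after (n : nat) (h : seq (move n)) : board n :=
  foldl (@write n) (empty_board n) h.

Definition has_SOO (n : nat) (b : board n) : bool :=
  [exists i : 'I_n, exists j : 'I_n, exists k : 'I_n,
    [&& val j == i.+1, val k == i.+2,
        b i == Some LetterS, b j == Some LetterO & b k == Some LetterO]].

Definition full (n : nat) (b : board n) : bool := [forall i, b i != None].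

Definition to_move (n : nat) (h : seq (move n)) : player :=
  if odd (size h) then Second else First.

Definition legal_move (n : nat) (b : board n) (m : move n) : Prop :=
  b m.1 = None.

(* The (possibly unfinished) plays; no move is made once SOO has appeared. *)
Inductive is_play (n : nat) : seq (move n) -> Prop :=
| play_start : is_play [::]
| play_move h m :
    is_play h -> ~~ has_SOO (board_after h) -> legal_move (board_after h) m ->
    is_play (rcons h m).

Definition ongoing (n : nat) (h : seq (move n)) : Prop :=
  [/\ is_play h, ~~ has_SOO (board_after h) & ~~ full (board_after h)].

(* In a play, the position before the last move contains no SOO, so an SOO
   present after that move was produced by it. *)
Definition loses (n : nat) (p : player) (h : seq (move n)) : Prop :=
  is_play h /\
  exists h' m, [/\ h = rcons h' m, to_move h' = p & has_SOO (board_after h)].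

(* A strategy may depend on the whole history of the play; its values where
   the player is not to move, or the play is over, are irrelevant. *)
Definition strategy (n : nat) := seq (move n) -> move n.

Definition strategy_for (n : nat) (p : player) (sigma : strategy n) : Prop :=
  forall h, ongoing h -> to_move h = p ->
    legal_move (board_after h) (sigma h).

Definition follows (n : nat) (p : player) (sigma : strategy n)
    (h : seq (move n)) : Prop :=
  forall h1 m h2, h = h1 ++ m :: h2 -> to_move h1 = p -> m = sigma h1.

Definition can_avoid_losing (n : nat) (p : player) : Prop :=
  exists sigma : strategy n,
    strategy_for p sigma /\
    forall h, is_play h -> follows p sigma h -> ~ loses p h.

Definition draw_with_optimal_play (n : nat) : Prop :=
  forall p : player, can_avoid_losing n p.

(* Main.v *)
Require Import Defs.
From mathcomp Require Import all_boot.

(** Either player can avoid losing by writing nothing but S, so the argument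
    is the same for both.

    Give every cell a neighbour as its guard: the cell on its left, or, for
    the leftmost cell, the cell on its right.  Call a board guarded when the
    guard of every O carries an S.  A guarded board has no two consecutive O's,
    hence no SOO, and writing an S into an empty cell keeps it guarded
    ([guarded_writeS]).  So a player who faces a guarded board may write an S
    anywhere, and the only way for the opponent to disturb the situation is to
    write an O whose guard is not an S.  If that guard is empty, writing S there
    restores guardedness.  The guard cannot carry an O: that older O is itself
    guarded by an S, which either contradicts that the new O went into an empty
    cell, or makes the opponent's move complete an SOO ([guard_reply]).

    Hence the player can leave a guarded board after each move, and never
    produces an SOO. *)

Set Implicit Arguments.
Unset Strict Implicit.
Unset Printing Implicit Defensive.

Section Guards.

Variable n : nat.
Implicit Types (b : board n) (i j x y : 'I_n).

(** The leftmost cell needs a guard as well: otherwise an O written there could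
    be followed by an O next to it, whose guard would then carry an O. *)
Definition guards j i : bool :=
  (val i == j.+1) || ((val i == 0) && (val j == 1)).

Definition guarded b : bool :=
  [forall i, forall j,
    guards j i ==> (b i == Some LetterO) ==> (b j == Some LetterS)].

Lemma guardedP b :
  reflect (forall i j, guards j i -> b i = Some LetterO -> b j = Some LetterS)
          (guarded b).
Proof.
apply: (iffP forallP) => [gb i j gji bi | gb i].
  by move/forallP: (gb i) => /(_ j); rewrite gji bi eqxx => /eqP.
by apply/forallP => j; apply/implyP => gji; apply/implyP => /eqP /(gb i j gji) ->.
Qed.

Lemma guards_inj i j j' : guards j i -> guards j' i -> j = j'.
Proof.
rewrite /guards => /orP[/eqP ij | /andP[/eqP i0 /eqP j1]].
  by rewrite ij /= orbF eqSS => /eqP jj'; apply/val_inj.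
by rewrite i0 /= => /eqP j'1; apply/val_inj; rewrite /= j1 j'1.
Qed.

Lemma has_SOO_intro b i j k :
  val j = i.+1 -> val k = i.+2 ->
  b i = Some LetterS -> b j = Some LetterO -> b k = Some LetterO -> has_SOO b.
Proof.
move=> ij ik bi bj bk; apply/existsP; exists i; apply/existsP; exists j.
by apply/existsP; exists k; rewrite ij ik bi bj bk !eqxx.
Qed.

Lemma guarded_no_SOO b : guarded b -> ~~ has_SOO b.
Proof.
move/guardedP=> gb; apply/negP => /existsP[i /existsP[j /existsP[k]]].
case/and5P=> /eqP ij /eqP ik _ /eqP bj /eqP bk.
have gjk : guards j k by rewrite /guards /= ij ik eqxx.
by move: (gb _ _ gjk bk); rewrite bj.
Qed.

Lemma guarded_empty : guarded (empty_board n).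
Proof. by apply/guardedP => i j _; rewrite ffunE. Qed.

Lemma guarded_writeS b y :
  b y = None -> guarded b -> guarded (write b (y, LetterS)).
Proof.
move=> y0 /guardedP gb; apply/guardedP => i j gji; rewrite !ffunE /=.
by case: (i == y) => // /(gb i j gji) ->; case: eqP.
Qed.

Definition restores b y : bool :=
  (b y == None) && guarded (write b (y, LetterS)).

Lemma not_full_empty_cell b : ~~ full b -> exists y, b y = None.
Proof. by case/forallPn => y /negPn /eqP; exists y. Qed.

Lemma guarded_restores b : guarded b -> ~~ full b -> exists y, restores b y.
Proof.
move=> gb /not_full_empty_cell[y y0].
by exists y; rewrite /restores y0 eqxx guarded_writeS.
Qed.

(** A guarded O cannot guard an empty cell [x] without an S just before it:
    the guard of that O is then the cell on its left, since it is not [x]. *)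
Lemma O_guard_SOO b x j :
  guarded b -> b x = None -> guards j x -> b j = Some LetterO ->
  has_SOO (write b (x, LetterO)).
Proof.
move=> /guardedP gb x0 gjx bj.
have not_guard : ~~ guards x j.
  by apply/negP => /gb /(_ bj); rewrite x0.
move: gjx not_guard; rewrite /guards => /orP[/eqP xj | /andP[/eqP x_0 /eqP j1]].
  rewrite xj /= eqSS; case: (posnP j) => [-> //| j_gt0 _].
  have k_lt : j.-1 < n by apply: leq_ltn_trans (leq_pred _) (ltn_ord j).
  have gkj : guards (Ordinal k_lt) j by rewrite /guards /= prednK ?eqxx.
  have bk := gb _ _ gkj bj.
  apply: (@has_SOO_intro _ (Ordinal k_lt) j x); rewrite /= ?prednK //.
  - by rewrite ffunE /=; case: eqP bk => // ->; rewrite x0.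
  - by rewrite ffunE /= bj; case: ifP.
  - by rewrite ffunE eqxx.
by rewrite /= j1 x_0.
Qed.

(** Writing an O can only break guardedness at that O, so the reply is to put
    an S on its guard if that is empty, and is free otherwise. *)
Lemma guard_reply b m :
  guarded b -> legal_move b m ->
  ~~ has_SOO (write b m) -> ~~ full (write b m) ->
  exists y, restores (write b m) y.
Proof.
case: m => x [] gb x0 noSOO notfull.
  by apply: guarded_restores => //; apply: guarded_writeS.
rewrite /legal_move /= in x0.
have keepS j : b j = Some LetterS -> write b (x, LetterO) j = Some LetterS.
  by rewrite ffunE /=; case: eqP => // ->; rewrite x0.
case: (pickP (fun j => guards j x && (b j == None))) => [j | no_empty_guard].
  case/andP=> gjx /eqP j0; exists j.
  have jx : j != x.
    by apply: contraTneq gjx => ->; rewrite /guards ltn_eqF //=; case: (val x).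
  apply/andP; split; first by rewrite ffunE /= (negPf jx) j0.
  apply/guardedP => i j' gj'i; rewrite ffunE /=; case: (i == j) => // bi.
  rewrite ffunE /=; case: eqP => // j'j; move: bi; rewrite ffunE /=.
  case: eqP => [ix _ | _ bi]; last exact/keepS/(guardedP _ gb _ _ gj'i bi).
  by rewrite ix in gj'i; case: j'j; apply: guards_inj gj'i gjx.
apply: guarded_restores => //; apply/guardedP => i j gji; rewrite ffunE /=.
case: eqP => [ix _ | _ bi]; last exact/keepS/(guardedP _ gb _ _ gji bi).
rewrite ix in gji; apply: keepS.
case bj: (b j) => [[]|] //; last by move: (no_empty_guard j); rewrite gji bj eqxx.
by rewrite (O_guard_SOO gb x0 gji bj) in noSOO.
Qed.

(** The second choice only makes the strategy legal in plays that do not follow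
    it, where no move may restore guardedness. *)
Definition guard_strategy (i0 : 'I_n) : strategy n := fun h =>
  let b := board_after h in
  (odflt (odflt i0 [pick y | b y == None]) [pick y | restores b y], LetterS).

Lemma guard_strategy_legal i0 p : strategy_for p (guard_strategy i0).
Proof.
move=> h [_ _ /not_full_empty_cell[z z0]] _.
rewrite /legal_move /guard_strategy /=.
case: (pickP (restores _)) => [y /andP[/eqP y0 _] // | _] /=.
by case: pickP => [y /eqP // | /(_ z)]; rewrite z0 eqxx.
Qed.

Lemma board_after_rcons (h : seq (move n)) m :
  board_after (rcons h m) = write (board_after h) m.
Proof. by rewrite /board_after -cats1 foldl_cat. Qed.

Lemma to_move_rcons (h : seq (move n)) m p :
  to_move (rcons h m) = p <-> to_move h <> p.
Proof. by rewrite /to_move size_rcons /=; case: odd; case: p. Qed.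

Lemma follows_rcons p (sigma : strategy n) h m :
  follows p sigma (rcons h m) ->
  follows p sigma h /\ (to_move h = p -> m = sigma h).
Proof.
move=> f; split=> [h1 m' h2 e |]; last by apply: (f h m [::]); rewrite -cats1.
by apply: (f h1 m' (rcons h2 m)); rewrite e rcons_cat.
Qed.

Lemma legal_not_full b m : legal_move b m -> ~~ full b.
Proof. by move=> m0; apply/forallPn; exists m.1; rewrite m0. Qed.

(** The two clauses feed each other: an opponent who starts from a guarded board
    leaves one that can be restored, and the strategy then restores it. *)
Lemma guard_strategy_invariant i0 p h :
  is_play h -> follows p (guard_strategy i0) h ->
  (to_move h <> p -> guarded (board_after h)) /\
  (to_move h = p -> ~~ has_SOO (board_after h) -> ~~ full (board_after h) ->
     exists y, restores (board_after h) y).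
Proof.
elim=> [_ | {}h m _ IH noSOO legal /follows_rcons[/IH[IHopp IHown] m_def]].
  by split=> *; [exact: guarded_empty | exact: guarded_restores guarded_empty _].
rewrite board_after_rcons; split=> [turn | /to_move_rcons turn]; last first.
  exact: guard_reply (IHopp turn) legal.
have {}turn : to_move h = p.
  by move: turn; rewrite /to_move size_rcons /=; case: odd; case: (p).
rewrite (m_def turn) /guard_strategy.
have [y yP] := IHown turn noSOO (legal_not_full legal).
by case: (pickP (restores _)) => [z /andP[_] // | /(_ y)]; rewrite yP.
Qed.

End Guards.

Theorem theorem10 (n : nat) (hn : 1 <= n) : draw_with_optimal_play n.
Proof.
move=> p; exists (guard_strategy (Ordinal hn)).
split=> [|h play_h follows_h]; first exact: guard_strategy_legal.
case=> _ [h' [m [h_def turn SOO]]].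
have [guarded_h _] := guard_strategy_invariant play_h follows_h.
suff /guarded_h /guarded_no_SOO : to_move h <> p by rewrite SOO.
by rewrite h_def => /to_move_rcons.
Qed.
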